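(* Let $M_n \in \mathbb{R}^{n\times n}$ be a matrix whose entries are i.i.d. random variables each distributed as the sum of $t$ independent uniformly random signs in $\{-1,+1\}$. Then for all sufficiently large $t$, $$\Pr[M_n \text{ is singular}] \le t^{-Cn},$$ where $C>0$ is an absolute constant. *)

(* Defs.v *)
From HB Require Import structures.
From mathcomp Require Import all_boot all_order all_algebra.
From mathcomp Require Import all_classical all_reals all_analysis.

Set Implicit Arguments.
Unset Strict Implicit.
Unset Printing Implicit Defensive.

Import Order.TTheory GRing.Theory Num.Theory.
Import numFieldNormedType.Exports.

Local Open Scope classical_set_scope.
Local Open Scope ring_scope.

Definition mutually_independent (R : realType) (d : measure_display)
    (T : measurableType d) (P : probability T R) (I : finType)
    (X : I -> {RV P >-> R}) : Prop :=
  forall (J : {set I}) (A : I -> set R),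
    (forall i, measurable (A i)) ->
    P (\bigcap_(i in [set` J]) (X i @^-1` A i)) =
    (\prod_(i in J) P (X i @^-1` A i))%E.

Definition uniform_sign (R : realType) (d : measure_display)
    (T : measurableType d) (P : probability T R) (e : {RV P >-> R}) : Prop :=
  P [set w | e w = 1] = (2^-1)%:E /\ P [set w | e w = -1] = (2^-1)%:E.

(* The signs live on an auxiliary probability space: only the law of [X] is
   constrained. *)
Definition distributed_as_sign_sum (R : realType) (d : measure_display)
    (T : measurableType d) (P : probability T R) (t : nat)
    (X : {RV P >-> R}) : Prop :=
  exists (d' : measure_display) (S : measurableType d')
         (Q : probability S R) (e : 'I_t -> {RV Q >-> R}),
    [/\ mutually_independent e,
        (forall k, uniform_sign (e k)) &
        forall A : set R, measurable A ->
          distribution P X A = Q [set s | A (\sum_(k < t) e k s)]].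

Definition random_matrix (R : realType) (d : measure_display)
    (T : measurableType d) (P : probability T R) (n : nat)
    (X : 'I_n * 'I_n -> {RV P >-> R}) (w : T) : 'M[R]_n :=
  \matrix_(i < n, j < n) X (i, j) w.

(* Main.v *)
(* Let X be a row of the matrix and Y a row whose entries are sums of about
   sqrt t signs. Two facts drive the argument.

   Comparison: for every proper subspace W, P(X in W) <= eps P(Y in W) with eps
   a negative power of t. A generic linear functional reduces this to the return
   probability of a walk on the real line, and doubling the number of steps of
   such a walk multiplies its return probability by at most 399/400: otherwise
   its law g would be almost uniform on the set L of its heavy atoms, but
   g is positive definite, so g is still heavy on L + L, which is too large.

   Replacement (after Kahn, Komlos and Szemeredi): let U be the span of the n
   rows, a proper subspace. If P(Y in U) is not tiny, then m = n/2 independent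
   copies of Y are linearly independent vectors of U with probability at least
   (P(Y in U) / 2)^m. Exposing the n rows after these m vectors, more than m of
   them fall into the span of what was exposed before, each time at a cost
   P(X in W) <= eps P(Y in W) <= eps P(Y in U). The powers of P(Y in U) cancel
   and eps^m remains. If P(Y in U) is tiny, a single such row is enough. *)

Require Import Defs.
From HB Require Import structures.
From mathcomp Require Import all_boot all_order all_algebra.
From mathcomp Require Import all_classical all_reals all_analysis.
From mathcomp Require Import ring lra zify.
Import Order.TTheory GRing.Theory Num.Theory.
Import numFieldNormedType.Exports.
Local Open Scope classical_set_scope.
Local Open Scope ring_scope.

Set Implicit Arguments.
Unset Strict Implicit.
Unset Printing Implicit Defensive.

Section SignWalks.
Variable R : realFieldType.

(** * Finite laws *)

(* A list stands for the law of a uniformly chosen entry, counted with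
   multiplicity; [avg] is then the expectation (and [0] for the empty list). *)
Definition avg (A : Type) (l : seq A) (F : A -> R) : R :=
  (\sum_(x <- l) F x) / (size l)%:R.

Lemma eq_avg (A : eqType) (l : seq A) (F G : A -> R) :
  {in l, F =1 G} -> avg l F = avg l G.
Proof. by move=> FG; rewrite /avg; congr (_ / _); apply: eq_big_seq. Qed.

Lemma le_avg (A : eqType) (l : seq A) (F G : A -> R) :
  {in l, forall x, F x <= G x} -> avg l F <= avg l G.
Proof.
move=> FG; rewrite /avg ler_wpM2r ?invr_ge0 //.
by rewrite big_seq [leRHS]big_seq; apply: ler_sum => x; apply: FG.
Qed.

Lemma avgZ (A : Type) (l : seq A) (k : R) (F : A -> R) :
  avg l (fun x => k * F x) = k * avg l F.
Proof. by rewrite /avg -mulr_sumr mulrA. Qed.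

Lemma avgD (A : Type) (l : seq A) (F G : A -> R) :
  avg l (fun x => F x + G x) = avg l F + avg l G.
Proof. by rewrite /avg big_split /= mulrDl. Qed.

Lemma avgB (A : Type) (l : seq A) (F G : A -> R) :
  avg l (fun x => F x - G x) = avg l F - avg l G.
Proof. by rewrite /avg sumrB mulrBl. Qed.

Lemma avg_sum (A B : Type) (l : seq A) (s : seq B) (F : A -> B -> R) :
  avg l (fun x => \sum_(z <- s) F x z) = \sum_(z <- s) avg l (fun x => F x z).
Proof. by rewrite /avg exchange_big /= mulr_suml. Qed.

Lemma avg_cst (A : Type) (l : seq A) (k : R) :
  (0 < size l)%N -> avg l (fun=> k) = k.
Proof.
move=> l0; rewrite /avg big_const_seq count_predT iter_addr_0 -[k *+ _]mulr_natr mulfK //.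
by rewrite pnatr_eq0 -lt0n.
Qed.

Lemma avg_ge0 (A : eqType) (l : seq A) (F : A -> R) :
  {in l, forall x, 0 <= F x} -> 0 <= avg l F.
Proof.
by move=> F0; rewrite /avg divr_ge0 // big_seq sumr_ge0.
Qed.

Lemma avg_le_cst (A : eqType) (l : seq A) (F : A -> R) (k : R) :
  0 <= k -> {in l, forall x, F x <= k} -> avg l F <= k.
Proof.
move=> k0 Fk; case: (posnP (size l)) => [/size0nil->|l0].
  by rewrite /avg big_nil mul0r.
by rewrite -[leRHS](avg_cst k l0) le_avg.
Qed.

Lemma avg_exchange (A B : Type) (l : seq A) (s : seq B) (F : A -> B -> R) :
  avg l (fun x => avg s (fun y => F x y)) =
  avg s (fun y => avg l (fun x => F x y)).
Proof.
rewrite /avg -!mulr_suml exchange_big /= -!mulrA; congr (_ * _).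
exact: mulrC.
Qed.

Lemma avg_map (A B : Type) (f : A -> B) (l : seq A) (F : B -> R) :
  avg (map f l) F = avg l (fun x => F (f x)).
Proof. by rewrite /avg big_map size_map. Qed.

Lemma avg_allpairs (A B D : Type) (f : A -> B -> D) (l : seq A) (s : seq B)
    (F : D -> R) :
  avg [seq f x y | x <- l, y <- s] F =
  avg l (fun x => avg s (fun y => F (f x y))).
Proof.
rewrite /avg big_allpairs_dep size_allpairs natrM invfM -mulr_suml.
by rewrite [_^-1 * _]mulrC mulrA.
Qed.

Lemma avg_seq1 (A : Type) (a : A) (F : A -> R) : avg [:: a] F = F a.
Proof. by rewrite /avg big_seq1 divr1. Qed.

(** For each entry [a] exactly one point of [S], namely [a - c], contributes. This converts sums
    over a finite support into expectations and back. *)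
Lemma avg_atoms (l S : seq R) (c : R) (F : R -> R) :
  uniq S -> {in l, forall a, a - c \in S} ->
  \sum_(z <- S) avg l (fun a => (a == z + c)%:R) * F z =
  avg l (fun a => F (a - c)).
Proof.
move=> uS lS.
under eq_bigr do rewrite mulrC -avgZ.
rewrite -avg_sum; apply: eq_avg => a al.
rewrite (bigD1_seq (a - c)) ?lS //= subrK eqxx mulr1 big1 ?addr0 // => z zac.
by rewrite -subr_eq eq_sym (negbTE zac) mulr0.
Qed.

Definition conv (V : nmodType) (l s : seq V) : seq V :=
  [seq x + y | x <- l, y <- s].

Definition symmetric_law (V : zmodType) (l : seq V) : Prop :=
  forall F, avg l (fun x => F (- x)) = avg l F.

Lemma conv_sym (V : zmodType) (l s : seq V) :
  symmetric_law l -> symmetric_law s -> symmetric_law (conv l s).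
Proof.
move=> hl hs F; rewrite !avg_allpairs.
rewrite -[RHS](hl (fun x => avg s (fun y => F (x + y)))).
rewrite /avg; congr (_ / _); apply: eq_bigr => x _.
rewrite -[in RHS]/(avg s (fun y => F (- x + y))) -[RHS](hs (fun y => F (- x + y))).
by rewrite /avg; congr (_ / _); apply: eq_bigr => y _; rewrite opprD.
Qed.

Definition atom (V : eqType) (l : seq V) (x : V) : R :=
  avg l (fun a => (a == x)%:R).

Lemma atom_ge0 (V : eqType) (l : seq V) x : 0 <= atom l x.
Proof. by apply: avg_ge0. Qed.

Lemma atom_eq0 (V : eqType) (l : seq V) x : x \notin l -> atom l x = 0.
Proof.
move=> xl; rewrite /atom /avg big_seq big1 ?mul0r // => a al.
by case: eqP => // ax; rewrite -ax al in xl.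
Qed.

(** * Return probabilities *)

Lemma decay_ge0 : 0 <= 1 - 400^-1 :> R.
Proof. lra. Qed.

Section SelfConvolution.
Variable l : seq R.
Hypothesis l_sym : symmetric_law l.
Let u := conv l l.
Let g := atom u.

(** By symmetry the sum of two independent draws has the law of their difference, so [g] is the
    autocorrelation of [atom l]; this is its positive definiteness. *)
Lemma atom_selfconv x : g x = avg l (fun a => atom l (a + x)).
Proof.
rewrite /g /atom avg_allpairs -[LHS]l_sym; apply: eq_avg => a _.
by apply: eq_avg => b _; rewrite addrC subr_eq addrC.
Qed.

Lemma corr_atoms (S : seq R) (c d : R) :
  uniq S -> {in l, forall a, a - c \in S} ->
  \sum_(z <- S) atom l (z + c) * atom l (z + d) = g (d - c).
Proof.
move=> uS lS; rewrite (avg_atoms (fun z => atom l (z + d)) uS lS).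
by rewrite atom_selfconv; apply: eq_avg => a _; rewrite addrAC addrA.
Qed.

(** A finite set supporting [atom l] and its translates by [x] and [y], so that their l^2 inner
    products become finite sums. *)
Let window (x y : R) : seq R :=
  undup (l ++ [seq a - x | a <- l] ++ [seq a - y | a <- l]).

Let windowP x y : [/\ uniq (window x y), {in l, forall a, a - 0 \in window x y},
  {in l, forall a, a - x \in window x y} & {in l, forall a, a - y \in window x y}].
Proof.
split; first exact: undup_uniq.
- by move=> a al; rewrite subr0 mem_undup mem_cat al.
- by move=> a al; rewrite mem_undup !mem_cat (map_f (fun a => a - x)) ?orbT.
- by move=> a al; rewrite mem_undup !mem_cat (map_f (fun a => a - y)) ?orbT.
Qed.

(** Inner products of translates are values of [g], so the gap between [g] and its value at [0]
    measures how far a translation moves [atom l]. *)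
Lemma sqdist_atoms (S : seq R) (c d : R) :
  uniq S -> {in l, forall a, a - c \in S} -> {in l, forall a, a - d \in S} ->
  \sum_(z <- S) (atom l (z + c) - atom l (z + d)) ^+ 2 = 2 * (g 0 - g (d - c)).
Proof.
move=> uS hc hd.
have E z : (atom l (z + c) - atom l (z + d)) ^+ 2 =
  atom l (z + c) * atom l (z + c) + atom l (z + d) * atom l (z + d) -
  2 * (atom l (z + c) * atom l (z + d)) by ring.
under eq_bigr do rewrite E.
rewrite sumrB big_split /= -mulr_sumr !corr_atoms // !subrr; ring.
Qed.

Lemma atom_selfconv_max x : g x <= g 0.
Proof.
have [uS h0 hx _] := windowP x x.
have := sqdist_atoms uS h0 hx; rewrite subr0 => E.
have : 0 <= 2 * (g 0 - g x) by rewrite -E sumr_ge0 // => z _; exact: sqr_ge0.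
by lra.
Qed.

(* The triangle inequality for the translates of [atom l] in l^2. *)
Lemma atom_selfconv_add x y :
  g 0 - g (x + y) <= 2 * (g 0 - g x) + 2 * (g 0 - g y).
Proof.
have [uS h0 hx hxy] := windowP x (x + y).
have E1 := sqdist_atoms uS h0 hx; have E2 := sqdist_atoms uS hx hxy.
have E3 := sqdist_atoms uS h0 hxy.
rewrite subr0 in E1; rewrite subr0 in E3; rewrite (addrC x) addrK (addrC y) in E2.
suff : 2 * (g 0 - g (x + y)) <=
  2 * (2 * (g 0 - g x)) + 2 * (2 * (g 0 - g y)) by lra.
rewrite -E1 -E2 -E3 !mulr_sumr -big_split /=; apply: ler_sum => z _.
(* For three values p, q, r the bound (p - r)^2 <= 2(p - q)^2 + 2(q - r)^2 has defect exactly (p -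
   2q + r)^2. *)
have := sqr_ge0 (atom l (z + 0) - 2 * atom l (z + x) + atom l (z + (x + y))).
by rewrite !expr2; nra.
Qed.

Lemma atom_selfconv_opp x : g (- x) = g x.
Proof.
rewrite /g /atom -[LHS](conv_sym l_sym l_sym).
by apply: eq_avg => a _; rewrite eqr_opp.
Qed.

(* Were the bound to fail, [u] would be nearly uniform on the set [L] of its
   heaviest atoms; translating the positive half of [L] by [max L] would then
   produce too much mass outside [L]. *)
Lemma return_decay : g 0 <= 2^-1 ->
  atom (conv u u) 0 <= (1 - 400^-1) * g 0.
Proof.
move=> g0_half.
have g00 : 0 <= g 0 by exact: atom_ge0.
have -> : atom (conv u u) 0 = avg u g.
  rewrite /atom avg_allpairs; apply: eq_avg => x _.
  rewrite -[RHS]atom_selfconv_opp; apply: eq_avg => y _.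
  by rewrite addrC addr_eq0.
have [g0|g0] := eqVneq (g 0) 0.
  by rewrite g0 mulr0; apply: avg_le_cst => // x _; rewrite -g0 atom_selfconv_max.
have {g00 g0} gp : 0 < g 0 by rewrite lt_def g0.
rewrite leNgt; apply/negP => big.
have u0 : (0 < size u)%N.
  rewrite lt0n; apply/eqP => /size0nil u0; move: gp.
  by rewrite /g /atom u0 /avg big_nil mul0r ltxx.
pose L x := (1 - 20^-1) * g 0 <= g x.
(* Markov's inequality: the mean of [g 0 - g x] is below [g 0 / 400], while each point outside [L]
   contributes more than [g 0 / 20]. *)
have outL : avg u (fun x => (~~ L x)%:R) < 20^-1.
  have : avg u (fun x => (20^-1 * g 0) * (~~ L x)%:R) <= avg u (fun x => g 0 - g x).
    apply: le_avg => x _; have := atom_selfconv_max x.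
    by rewrite /L -ltNge; case: ltP => /= h; rewrite ?mulr1 ?mulr0; lra.
  rewrite avgZ avgB avg_cst // => h.
  have : (20^-1 * g 0) * avg u (fun x => (~~ L x)%:R) < (20^-1 * g 0) * 20^-1 by lra.
  by rewrite ltr_pM2l //; lra.
have Lu x : L x -> x \in u.
  move=> Lx; apply: contraT => /(atom_eq0) gx; move: Lx.
  by rewrite /L /g gx; move: gp; rewrite /g; lra.
have L0 : L 0 by rewrite /L; lra.
have [M [LM maxM]] : exists M, L M /\ forall x, L x -> x <= M.
  pose M := \big[Order.max/0]_(x <- u | L x) x.
  (* The default value [0] of the maximum is harmless, since [0] lies in [L]. *)
  exists M; split.
    by apply: (big_ind L) => // x y Lx Ly; rewrite /Order.max; case: ifP.
  by move=> x Lx; apply: le_bigmax_seq => //; exact: Lu.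
(* The origin has mass at most 1/2, and symmetry splits the rest evenly between the two
   half-lines. *)
have posU : 4^-1 <= avg u (fun x => (0 < x)%R%:R).
  have : avg u (fun x => (0 < x)%R%:R + (0 < - x)%R%:R + (x == 0)%:R) = 1.
    rewrite -[RHS](avg_cst 1 u0); apply: eq_avg => x _; rewrite oppr_gt0.
    by case: (ltrgtP x 0) => // _; rewrite ?addr0 ?add0r.
  rewrite 2!avgD (conv_sym l_sym l_sym (fun x => (0 < x)%R%:R)) -/(atom u 0) -/g; lra.
pose H y := L y && (0 < y).
(* For [y] in [H] the point [M + y] exceeds [M], so it is outside [L]; yet its deficit is at most
   2/20 + 2/20 = 1/5 of [g 0]. Translation by [M] thus carries most of the mass of [H] out of
   [L]. *)
have heavy : (1 - 5^-1) * avg u (fun y => (H y)%:R) <= avg u (fun x => (~~ L x)%:R).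
  have -> : avg u (fun y => (H y)%:R) = \sum_(y <- undup u) g y * (H y)%:R.
    rewrite -[RHS]/(\sum_(y <- undup u) atom u y * (H y)%:R).
    under eq_bigr do rewrite -[X in atom u X]addr0.
    rewrite (avg_atoms (fun y => (H y)%:R)) ?undup_uniq // => [|a].
      by apply: eq_avg => a _; rewrite subr0.
    by rewrite subr0 mem_undup.
  rewrite mulr_sumr.
  apply: (@le_trans _ _ (\sum_(y <- undup u) g (M + y) * (H y)%:R)).
    apply: ler_sum => y _; rewrite mulrA; case Hy: (H y); rewrite ?mulr0 // !mulr1.
    have /andP[Ly _] := Hy; have := atom_selfconv_add M y.
    have := atom_selfconv_max y; move: LM Ly; rewrite /L; lra.
  under eq_bigr do rewrite mulrC -avgZ.
  rewrite -avg_sum; apply: le_avg => x _.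
  have [xM|xM] := boolP (x - M \in undup u); last first.
    rewrite big_seq big1 // => y yu; case: eqP => [xE|_]; last by rewrite mulr0.
    by rewrite xE addrC addKr yu in xM.
  rewrite (bigD1_seq (x - M)) ?undup_uniq //= big1 ?addr0 => [|y yx].
    rewrite [M + _]addrC subrK eqxx mulr1; case Hx: (H _) => //.
    suff -> : ~~ L x by [].
    apply/negP => /maxM; have /andP[_] := Hx; lra.
  case: eqP => [xE|_]; last by rewrite mulr0.
  by move/negP: yx; rewrite xE addrC addKr eqxx.
(* Contradiction: the positive half has mass at least 1/4, but [H] and the complement of [L]
   together have less than 1/16 + 1/20. *)
have : avg u (fun x => (0 < x)%R%:R) <= avg u (fun y => (H y)%:R + (~~ L y)%:R).
  apply: le_avg => x _; rewrite /H.
  by case: (L x); case: (0 < x); rewrite /= ?addr0 ?add0r.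
by rewrite avgD; lra.
Qed.

End SelfConvolution.

(** * Random linear combinations *)

(* The law of [\sum_u x_u *: u] with independent coefficients [x_u] of law [c]. *)
Definition comb (V : lmodType R) (us : seq V) (c : seq R) : seq V :=
  foldr (fun u l => conv [seq x *: u | x <- c] l) [:: 0] us.

Lemma avg_comb_cons (V : lmodType R) (u : V) us c (F : V -> R) :
  avg (comb (u :: us) c) F =
  avg c (fun x => avg (comb us c) (fun y => F (x *: u + y))).
Proof. by rewrite /= avg_allpairs avg_map. Qed.

Lemma comb_size_gt0 (V : lmodType R) (us : seq V) c :
  (0 < size c)%N -> (0 < size (comb us c))%N.
Proof.
by move=> c0; elim: us => //= u us IH; rewrite size_allpairs size_map muln_gt0 c0.
Qed.

Lemma avg_comb_cat (V : lmodType R) (us vs : seq V) c (F : V -> R) :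
  avg (comb (us ++ vs) c) F =
  avg (comb us c) (fun x => avg (comb vs c) (fun y => F (x + y))).
Proof.
elim: us F => [|u us IH] F.
  by rewrite avg_seq1; apply: eq_avg => y _; rewrite add0r.
rewrite cat_cons !avg_comb_cons; apply: eq_avg => x _; rewrite IH.
by do 2!apply: eq_avg => ? _; rewrite addrA.
Qed.

Lemma eq_avg_comb (V : lmodType R) (us : seq V) c d :
  (forall F : R -> R, avg c F = avg d F) ->
  forall F, avg (comb us c) F = avg (comb us d) F.
Proof.
move=> cd; elim: us => [//|u us IH] F.
by rewrite !avg_comb_cons cd; apply: eq_avg => x _; rewrite IH.
Qed.

(** Splitting every coefficient into two independent summands splits the whole combination, which
    makes the number of signs per coefficient the time of a walk. *)
Lemma avg_comb_conv (V : lmodType R) (us : seq V) c d (F : V -> R) :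
  avg (comb us (conv c d)) F = avg (conv (comb us c) (comb us d)) F.
Proof.
rewrite avg_allpairs; elim: us F => [|u us IH] F.
  by rewrite !avg_seq1 addr0.
rewrite !avg_comb_cons avg_allpairs; apply: eq_avg => x _.
under [RHS]eq_avg do rewrite avg_comb_cons.
rewrite [RHS]avg_exchange; apply: eq_avg => x' _.
rewrite IH; do 2!apply: eq_avg => ? _; congr F.
by rewrite scalerDl addrACA.
Qed.

Lemma avg_comb_linear (V W : lmodType R) (f : {linear V -> W}) (us : seq V) c
    (F : W -> R) :
  avg (comb [seq f u | u <- us] c) F = avg (comb us c) (fun x => F (f x)).
Proof.
elim: us F => [|u us IH] F; first by rewrite !avg_seq1 linear0.
rewrite map_cons !avg_comb_cons; apply: eq_avg => x _; rewrite IH.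
by apply: eq_avg => y _; rewrite linearP.
Qed.

Lemma comb_sym (V : lmodType R) (us : seq V) c :
  symmetric_law c -> symmetric_law (comb us c).
Proof.
move=> hc; elim: us => [|u us IH] F; first by rewrite !avg_seq1 oppr0.
rewrite !avg_comb_cons -[RHS]hc; apply: eq_avg => x _.
rewrite -[RHS]IH; apply: eq_avg => y _.
by rewrite opprD scaleNr.
Qed.

Lemma mem0_comb (V : lmodType R) (us : seq V) c : 0 \in c -> 0 \in comb us c.
Proof.
move=> c0; elim: us => [|u us IH]; first by rewrite inE.
apply/allpairsP; exists (0, 0); rewrite addr0; split => //=.
by apply/mapP; exists 0; rewrite ?scale0r.
Qed.

Lemma dim_addv_line (V : vectType R) (W : {vspace V}) x :
  x \notin W -> \dim (W + <[x]>) = (\dim W).+1.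
Proof.
move=> xW; rewrite dimv_disjoint_sum ?dim_vline; last first.
  apply/eqP; rewrite -subv0; apply/subvP => v.
  rewrite memv_cap => /andP[vW /vlineP[k vE]].
  rewrite memv0 vE scaler_eq0; case: eqP => //= /eqP k0.
  by case/negP: xW; rewrite -[x]scale1r -(mulVf k0) -scalerA -vE memvZ.
case: eqP => [x0|_]; last by rewrite addn1.
by rewrite x0 mem0v in xW.
Qed.

(* Odlyzko's bound: each vector enlarging [W] costs a factor [eta]. *)
Lemma comb_subspace_le (V : vectType R) (us : seq V) c (eta : R)
    (W : {vspace V}) (z : V) :
  0 <= eta -> (forall x, atom c x <= eta) ->
  avg (comb us c) (fun y => (z + y \in W)%:R) <=
  eta ^+ (\dim (W + <<us>>) - \dim W).
Proof.
move=> eta0 ceta; elim: us W z => [|u us IH] W z.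
  by rewrite span_nil addv0 subnn expr0; apply: avg_le_cst => // y _; case: (_ \in _).
rewrite avg_comb_cons span_cons addvA.
have [uW|uW] := boolP (u \in W).
  have -> : (W + <[u]> = W)%VS by apply/addv_idPl.
  apply: avg_le_cst => [|x _]; first exact: exprn_ge0.
  apply: le_trans (IH W z); apply: le_avg => y _.
  by rewrite addrCA rpredDl ?memvZ.
have dW := dim_addv_line uW.
have dle : (\dim W < \dim (W + <[u]> + <<us>>))%N.
  by rewrite -dW; apply: dimvS; exact: addvSl.
rewrite avg_exchange.
rewrite -(subnSK dle) exprS -dW.
apply: le_trans (ler_wpM2l eta0 (IH _ z)); rewrite -avgZ; apply: le_avg => y _.
(* With the other coefficients fixed, membership in [W] forces [z + y] into [W + <[u]>], and then
   only the value [- k] of the coefficient of [u] is possible. *)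
have [/memv_addP[w wW [_ /vlineP[k ->] zy]]|zyW] := boolP (z + y \in _); last first.
  rewrite mulr0; apply: avg_le_cst => // x _.
  case: (boolP (_ \in W)) => // h; case/negP: zyW.
  have -> : z + y = (z + (x *: u + y)) + (- x *: u).
    by rewrite (addrCA z) scaleNr (addrC (x *: u)) addrK.
  by rewrite memv_add ?memvZ ?memv_line.
rewrite mulr1; apply: le_trans (ceta (- k)); apply: le_avg => x _.
rewrite ler_nat addrCA zy addrCA rpredDl // -scalerDl.
case: (boolP (_ \in W)) => // h; rewrite -addr_eq0; case: eqP => // /eqP xk.
by case/negP: uW; rewrite -[u]scale1r -(mulVf xk) -scalerA memvZ.
Qed.

(** * Sums of signs and the walks they drive *)

Definition signs (t : nat) : seq R := comb (nseq t (1 : R^o)) [:: 1; -1].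

Lemma avg_signs0 (F : R -> R) : avg (signs 0) F = F 0.
Proof. exact: (@avg_seq1 R^o). Qed.

Lemma avg_signsS t (F : R -> R) :
  avg (signs t.+1) F =
  (avg (signs t) (fun y => F (1 + y)) + avg (signs t) (fun y => F (-1 + y))) / 2.
Proof.
have := avg_comb_cons (1 : R^o) (nseq t 1) [:: 1; -1] F.
rewrite -[comb _ _]/(signs t.+1) -[comb (nseq t 1) _]/(signs t) => ->.
rewrite {1}/avg !big_cons big_nil addr0 /GRing.scale /=.
by rewrite !mulr1.
Qed.

Lemma signs_size_gt0 t : (0 < size (signs t))%N.
Proof. exact: comb_size_gt0. Qed.

Lemma avg_signsD s t (F : R -> R) :
  avg (signs (s + t)) F = avg (conv (signs s) (signs t)) F.
Proof.
rewrite avg_allpairs.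
by have := avg_comb_cat (nseq s (1 : R^o)) (nseq t 1) [:: 1; -1] F; rewrite -nseqD.
Qed.

Lemma signs_sym t : symmetric_law (signs t).
Proof.
apply: (@comb_sym R^o) => F.
by rewrite /avg !big_cons !big_nil opprK !addr0 addrC.
Qed.

Section Return.
Variable us : seq R^o.
Hypothesis us_neq0 : has (fun u => u != 0) us.

(** A walk at time [t]: each step adds every vector of [us] with its own random sign. *)
Let w t : seq R := comb us (signs t).
Let ret t : R := atom (w t) 0.

Let avg_wD s t (F : R -> R) : avg (w (s + t)) F = avg (conv (w s) (w t)) F.
Proof. by rewrite (eq_avg_comb us (avg_signsD s t)) avg_comb_conv. Qed.

Let w_sym t : symmetric_law (w t).
Proof. exact/(@comb_sym R^o)/signs_sym. Qed.

(** Condition on the first [t - (s + s)] steps: the rest must hit a prescribed point, and at an even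
    time the origin is the likeliest one. *)
Lemma return_mono s t : (s + s <= t)%N -> ret t <= ret (s + s).
Proof.
move=> st; rewrite /ret -(subnK st) /atom avg_wD avg_allpairs.
apply: avg_le_cst => [|x _]; first exact: avg_ge0.
rewrite [X in _ <= X]avg_wD; apply: le_trans (atom_selfconv_max (w_sym s) (- x)).
rewrite -[X in _ <= X]avg_wD; apply: le_avg => y _.
by rewrite addrC addr_eq0.
Qed.

(** Two signs have atoms 1/4, 1/2, 1/4, and Odlyzko's bound for the zero subspace gains at least one
    factor 1/2. This supplies the hypothesis of [return_decay] at all later even times. *)
Lemma return2 : ret 2 <= 2^-1.
Proof.
have h x : atom (signs 2) x <= 2^-1.
  rewrite /atom !avg_signsS !avg_signs0 !addr0 subrr addNr.
  have [->|x0] := eqVneq x 0.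
    by do 2!case: eqP => [?|_] /=; lra.
  by do 2!case: eqP => [?|_] /=; lra.
have h0 : 0 <= 2^-1 :> R by lra.
have := comb_subspace_le us 0%VS 0 h0 h.
rewrite add0v dimv0 subn0 => H.
apply: (@le_trans _ _ (2^-1 ^+ \dim <<us>>)).
  by apply: le_trans H; apply: le_avg => y _; rewrite add0r memv0.
have d0 : (0 < \dim <<us>>)%N.
  rewrite lt0n dimv_eq0; apply/eqP => us0.
  have /hasP[x xus] := us_neq0; rewrite -memv0 -us0 memv_span //.
by rewrite -(prednK d0) exprS ler_piMr // exprn_ile1 //; lra.
Qed.

Lemma return_double s : (0 < s)%N ->
  ret (s + s + (s + s)) <= (1 - 400^-1) * ret (s + s).
Proof.
move=> s0; have h : ret (s + s) <= 2^-1.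
  by apply: le_trans return2; apply: (@return_mono 1); rewrite leq_add.
have E : ret (s + s) = atom (conv (w s) (w s)) 0 by rewrite /ret /atom avg_wD.
rewrite E in h *; apply: le_trans (return_decay (w_sym s) h).
rewrite /ret /atom avg_wD !avg_allpairs avg_wD !avg_allpairs.
do 2!apply: le_avg => ? _.
by rewrite avg_wD.
Qed.

(** The successors in the exponents keep every time even, as [return_double] requires. *)
Lemma return_pow2 i k :
  ret (2 ^ (i + k).+1) <= (1 - 400^-1) ^+ k * ret (2 ^ i.+1).
Proof.
elim: k => [|k IH]; first by rewrite addn0 expr0 mul1r.
have := @return_double (2 ^ (i + k)) (expn_gt0 _ _).
rewrite !addnn -!mul2n -!expnS addnS => /le_trans; apply.
rewrite exprS -mulrA; by apply: ler_wpM2l; [exact: decay_ge0|exact: IH].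
Qed.

End Return.

Lemma atom_signs_max s x : atom (signs (s + s)) x <= atom (signs (s + s)) 0.
Proof.
by rewrite /atom !avg_signsD; exact: (atom_selfconv_max (@signs_sym s)).
Qed.

(** The walk with the single step [1], started at time 2 and doubled [i] times. *)
Lemma atom_signs_pow2 i x : atom (signs (2 ^ i.+1)) x <= (1 - 400^-1) ^+ i.
Proof.
rewrite expnS mul2n -addnn; apply: le_trans (atom_signs_max _ _) _.
rewrite addnn -mul2n -expnS.
have us0 : has (fun u : R^o => u != 0) [:: 1] by rewrite /= oner_eq0.
have := return_pow2 us0 0 i; rewrite add0n expn1 => h.
have E t : atom (comb [:: 1 : R^o] (signs t)) 0 = atom (signs t) 0.
  rewrite /atom avg_comb_cons; apply: eq_avg => y _.
  by rewrite avg_seq1 addr0 /GRing.scale /= mulr1.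
rewrite E in h; apply: le_trans h _.
apply: ler_piMr; first by apply: exprn_ge0; exact: decay_ge0.
by apply: le_trans (return2 us0) _; lra.
Qed.

(** Zero is the heaviest atom at an even time, and a nonempty list has a positive atom. *)
Lemma mem0_signs s : 0 \in signs (s + s).
Proof.
apply: contraT => /atom_eq0 a0.
have : avg (signs (s + s)) (fun=> 1) <= 0.
  rewrite -[X in X <= _]mulr1.
  have h : (0 < size (signs (s + s)))%N by exact: signs_size_gt0.
  case: (signs (s + s)) (@atom_signs_max s) a0 h => // x l /(_ x) mx a0 _.
  move: mx; rewrite a0 /atom /avg big_cons eqxx => mx.
  exfalso; move: mx; apply/negP; rewrite -ltNge divr_gt0 ?ltr0n //.
  by rewrite ltr_pwDl // sumr_ge0.
by rewrite avg_cst ?signs_size_gt0 // ler10.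
Qed.

(** * From subspaces to walks on the line *)

Lemma exists_nonroot (p : {poly R}) : p != 0 -> exists z, p.[z] != 0.
Proof.
move=> p0; pose rs := [seq i%:R : R | i <- iota 0 (size p)].
have [/(max_poly_roots p0)|/allPn[z _ pz]] := boolP (all (root p) rs); last by exists z.
rewrite map_inj_uniq ?iota_uniq => [/(_ isT)|x y /eqP]; last by rewrite eqr_nat => /eqP.
by rewrite size_map size_iota ltnn.
Qed.

(* Evaluation along the moment curve separates finitely many vectors. *)
Lemma separating_functional (V : vectType R) (W : {vspace V}) (s : seq V) :
  exists f : {linear V -> R^o}, {in s, forall x, (f x == 0) = (x \in W)}.
Proof.
(* The projection onto a complement of [W] along [W], whose kernel is [W]. *)
pose h := daddv_pi (W^C) W.
have hW x : (h x == 0) = (x \in W).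
  have xE := daddv_pi_add (capv_compl W); have := xE x.
  rewrite addv_complf memvf => /(_ isT) {}xE.
  apply/eqP/idP => [hx|xW]; first by rewrite -xE -/h hx addr0 memv_pi.
  have := daddv_pi_id (capv_compl W) xW => pix.
  by apply: (@addrI _ x); rewrite addr0 -{1}pix -/h xE.
pose r x : 'rV[R]_(\dim {:V}) := \row_i coord (vbasis fullv) i (h x).
have lr : linear r by move=> k x y; apply/rowP => i; rewrite !mxE !linearP.
have r0 x : h x = 0 -> r x = 0.
  by move=> hx; apply/rowP => i; rewrite !mxE hx linear0.
pose p x : {poly R} := rVpoly (r x).
have p0 x : p x = 0 -> x \in W.
  rewrite -hW => px; have rx : r x = 0 by rewrite -(rVpolyK (r x)) -/(p x) px linear0.
  rewrite (coord_vbasis (memvf (h x))) big1 // => i _.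
  by have /rowP/(_ i) := rx; rewrite !mxE => ->; rewrite scale0r.
(* The coordinates of [h x] are the coefficients of [p x]; one common non-root [z] then separates
   from [W] all entries of [s] outside [W]. *)
have [z] : exists z, (\prod_(x <- s | x \notin W) p x).[z] != 0.
  apply: exists_nonroot; rewrite prodf_seq_neq0; apply/allP => x _.
  by apply/implyP; apply: contra => /eqP/p0.
rewrite horner_prod prodf_seq_neq0 => /allP zP.
pose f (x : V) : R^o := (p x).[z].
have lf : linear f by move=> k x y; rewrite /f /p lr linearP /= hornerD hornerZ.
pose F : {linear V -> R^o} := HB.pack f (GRing.isLinear.Build R V R^o *:%R f lf).
exists F => x xs; apply/idP/idP => [fx|]; last first.
  by rewrite -hW => /eqP hx; rewrite /F /= /f /p r0 // linear0 horner0.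
by apply: contraT => xW; have := zP x xs; rewrite xW /= => /negP; case.
Qed.

(** A functional that vanishes, among the finitely many vectors involved, exactly on those in [W]
    turns membership in [W] into the return of a real walk. *)
Lemma subspace_decay (V : vectType R) (us : seq V) (W : {vspace V}) (i k t : nat) :
  <<us>>%VS = fullv -> W != fullv -> (2 ^ (i + k).+1 <= t)%N ->
  avg (comb us (signs t)) (fun x => (x \in W)%:R) <=
  (1 - 400^-1) ^+ k * avg (comb us (signs (2 ^ i.+1))) (fun x => (x \in W)%:R).
Proof.
move=> usT WT kt.
set X := comb us (signs t); set Y := comb us (signs _).
(* Including [us] ensures that the real walk has a nonzero step: otherwise [us] would lie in the
   proper subspace [W]. *)
have [f fW] := separating_functional W (us ++ X ++ Y).
have us0 : has (fun u : R^o => u != 0) [seq f u | u <- us].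
  apply: contraT; rewrite -all_predC all_map => /allP us0.
  case/negP: WT; rewrite eqEsubv subvf -usT; apply/span_subvP => u uus.
  by rewrite -fW ?mem_cat ?uus //; have := us0 u uus; rewrite /= negbK.
have E c : {subset comb us c <= us ++ X ++ Y} ->
    avg (comb us c) (fun x => (x \in W)%:R) = atom (comb (map f us) c) 0.
  move=> cXY; rewrite /atom (avg_comb_linear f us c (fun y => (y == 0)%:R)).
  by apply: eq_avg => x xc; rewrite fW ?cXY.
rewrite !E; [|by move=> x xY; rewrite !mem_cat xY !orbT..].
apply: le_trans (return_pow2 us0 i k).
have := kt; rewrite expnS mul2n -addnn => h.
exact: (return_mono _ h).
Qed.

(** * Exposing the rows *)

Fixpoint samples (A : Type) (l : seq A) (k : nat) : seq (seq A) :=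
  if k is k'.+1 then [seq x :: s | x <- l, s <- samples l k'] else [:: [::]].

Lemma avg_samplesS (A : Type) (l : seq A) k (F : seq A -> R) :
  avg (samples l k.+1) F = avg l (fun x => avg (samples l k) (fun s => F (x :: s))).
Proof. exact: avg_allpairs. Qed.

Lemma size_samples (A : eqType) (l : seq A) k s : s \in samples l k -> size s = k.
Proof.
elim: k s => [|k IH] s; first by rewrite inE => /eqP->.
by case/allpairsP=> -[x r] [_ /= /IH<- ->].
Qed.

Definition hits (V : vectType R) (l : seq V) (W : {vspace V}) : R :=
  avg l (fun x => (x \in W)%:R).

Lemma hits_ge0 (V : vectType R) (l : seq V) W : 0 <= hits l W.
Proof. exact: avg_ge0. Qed.

Lemma hits_le1 (V : vectType R) (l : seq V) W : hits l W <= 1.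
Proof. by apply: avg_le_cst => // x _; case: (_ \in _). Qed.

Lemma hitsS (V : vectType R) (l : seq V) W U : (W <= U)%VS -> hits l W <= hits l U.
Proof.
move=> /subvP WU; apply: le_avg => x _; rewrite ler_nat.
by case: (boolP (x \in W)) => // /WU->.
Qed.

Lemma hits_gt0 (V : vectType R) (l : seq V) W : 0 \in l -> 0 < hits l W.
Proof.
move=> l0; rewrite /hits /avg divr_gt0 //; last first.
  by rewrite ltr0n; case: l l0.
rewrite (perm_big _ (perm_to_rem l0)) big_cons mem0v /= ltr_pwDl //.
by apply: sumr_ge0.
Qed.

Section Exposure.
Variables (V : vectType R) (lx ly : seq V) (eps eta : R).
Hypotheses (eps_gt0 : 0 < eps) (eps_le1 : eps <= 1).
Hypotheses (eta_ge0 : 0 <= eta) (eta_le1 : eta <= 1).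
Hypothesis hits_xy : forall W, W != fullv -> hits lx W <= eps * hits ly W.
Hypothesis hits_y : forall W, hits ly W <= eta ^+ (\dim {:V} - \dim W).
Hypotheses (lx_gt0 : (0 < size lx)%N) (ly0 : 0 \in ly).

(* Every sample lying in the span of its predecessors is rewarded by the factor
   that compensates, on average, for the rarity of that event. *)
Fixpoint weight (W : {vspace V}) (s : seq V) : R :=
  if s is x :: s' then
    (if (x \in W) && (W != fullv) then (eps * hits ly W)^-1 else 1) *
    weight (W + <[x]>)%VS s'
  else 1.

Let epsq_gt0 W : 0 < eps * hits ly W.
Proof. by rewrite mulr_gt0 ?hits_gt0. Qed.

Let epsq_le1 W : eps * hits ly W <= 1.
Proof. by apply: mulr_ile1; rewrite ?hits_ge0 ?hits_le1 ?(ltW eps_gt0). Qed.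

Lemma weight_ge0 W s : 0 <= weight W s.
Proof.
elim: s W => [//|x s IH] W /=; rewrite mulr_ge0 //.
by case: ifP => // _; rewrite invr_ge0 ltW.
Qed.

(** Given the past, the expected factor of one row is at most 1 + [hits lx W / (eps * hits ly W)],
    hence at most 2. *)
Lemma avg_weight W k : avg (samples lx k) (weight W) <= 2 ^+ k.
Proof.
elim: k W => [|k IH] W; first by rewrite avg_seq1.
rewrite avg_samplesS /=.
pose G x : R := if (x \in W) && (W != fullv) then (eps * hits ly W)^-1 else 1.
have G0 x : 0 <= G x by rewrite /G; case: ifP => // _; rewrite invr_ge0 ltW.
apply: (@le_trans _ _ (avg lx (fun x => 2 ^+ k * G x))).
  apply: le_avg => x _; rewrite avgZ [leLHS]mulrC.
  by apply: ler_wpM2r; [exact: G0|exact: IH].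
rewrite avgZ exprSr ler_wpM2l ?exprn_ge0 //.
have [WT|WT] := eqVneq W fullv.
  apply: avg_le_cst => // x _; rewrite /G WT eqxx andbF; lra.
apply: (@le_trans _ _ (avg lx (fun x => 1 + (eps * hits ly W)^-1 * (x \in W)%:R))).
  apply: le_avg => x _; rewrite /G WT andbT; have := epsq_gt0 W; rewrite -invr_gt0.
  by case: (x \in W); rewrite ?mulr1 ?mulr0; lra.
rewrite avgD avg_cst // avgZ -/(hits lx W) mulrC.
suff : hits lx W / (eps * hits ly W) <= 1 by lra.
by rewrite ler_pdivrMr // mul1r hits_xy.
Qed.

(** [N] counts the entries lying in the span of what precedes them. Each is rewarded by the inverse
    of [eps * hits ly] of that span, and this only increases when the final span is replaced by a
    smaller one. *)
Lemma weight_lower W s N :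
  (W + << s >>)%VS != fullv -> (N + \dim (W + << s >>) = size s + \dim W)%N ->
  1 <= weight W s * (eps * hits ly (W + << s >>)%VS) ^+ N.
Proof.
elim: s W N => [|x s IH] W N.
  rewrite span_nil addv0 => _ /eqP; rewrite eqn_add2r => /eqP->.
  by rewrite expr0 mulr1.
rewrite span_cons addvA /= => UT NE.
have WU : (W <= W + <[x]> + << s >>)%VS.
  by apply: subv_trans (addvSl _ _); exact: addvSl.
have WT : W != fullv.
  by apply: contraNneq UT => WT; rewrite eqEsubv subvf -WT.
rewrite WT andbT; case: (boolP (x \in W)) => xW; last first.
  by rewrite mul1r; apply: IH => //; rewrite dim_addv_line //; lia.
have E : (W + <[x]> = W)%VS by apply/addv_idPl.
have := IH W; rewrite E in UT NE WU *; move=> {}IH.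
have N0 : (0 < N)%N by have := dim_span s; have := (dimv_add_leqif W << s >>).1; lia.
have {}IH := IH N.-1 UT; rewrite -(prednK N0) exprS.
apply: (@le_trans _ _ (weight W s * (eps * hits ly (W + << s >>)%VS) ^+ N.-1)).
  by apply: IH; lia.
set Q := eps * hits ly (W + << s >>)%VS; set q := eps * hits ly W.
have qQ : q <= Q by rewrite ler_wpM2l ?hitsS // ltW.
rewrite [leRHS](_ : _ = (q^-1 * Q) * (weight W s * Q ^+ N.-1)); last by ring.
rewrite ler_peMl //; last by rewrite mulrC ler_pdivlMr ?mul1r // epsq_gt0.
by rewrite mulr_ge0 ?weight_ge0 ?exprn_ge0 // ltW // epsq_gt0.
Qed.

(** Freeness modulo [W], tested one entry at a time to match the recursion of [samples]. *)
Fixpoint independent_in (U W : {vspace V}) (s : seq V) : bool :=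
  if s is y :: s' then
    [&& y \in U, y \notin W & independent_in U (W + <[y]>)%VS s']
  else true.

Lemma independent_inP U W s : independent_in U W s ->
  (<< s >> <= U)%VS /\ \dim (W + << s >>) = (\dim W + size s)%N.
Proof.
elim: s W => [|y s IH] W /=; first by rewrite span_nil sub0v addv0 addn0.
case/and3P=> yU yW /IH[sU dE]; rewrite span_cons; split.
  by rewrite subv_add sU andbT -memvE.
by rewrite addvA dE dim_addv_line // addSnnS.
Qed.

(** The span built so far has dimension at most [m], so [hits_y] bounds its mass by half of that of
    [U]; each draw thus lands in [U] but outside that span with probability at least
    [hits ly U / 2]. *)
Lemma avg_independent U W k m :
  2 * eta ^+ (\dim {:V} - m) <= hits ly U -> (\dim W + k <= m)%N ->
  (hits ly U / 2) ^+ k <=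
  avg (samples ly k) (fun s => (independent_in U W s)%:R).
Proof.
move=> qU; elim: k W => [|k IH] W Wm; first by rewrite avg_seq1.
set q := hits ly U / 2; have q0 : 0 <= q ^+ k.
  by rewrite exprn_ge0 // divr_ge0 // hits_ge0.
rewrite avg_samplesS.
apply: (@le_trans _ _ (avg ly (fun y => q ^+ k * ((y \in U)%:R - (y \in W)%:R)))).
  rewrite avgZ exprSr ler_wpM2l // avgB -/(hits ly U) -/(hits ly W).
  have : hits ly W <= eta ^+ (\dim {:V} - m).
    by apply: le_trans (hits_y W) _; apply: ler_wiXn2l => //; lia.
  by rewrite /q; lra.
apply: le_avg => y _ /=.
have [yU|yU] := boolP (y \in U); last first.
  apply: (@le_trans _ _ 0); last exact: avg_ge0.
  by rewrite mulr_ge0_le0 // sub0r oppr_le0.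
have [yW|yW] := boolP (y \in W).
  by rewrite subrr mulr0; exact: avg_ge0.
rewrite subr0 mulr1 /=; apply: IH; rewrite dim_addv_line //; lia.
Qed.

(* The summand [eta ^+ _] accounts for spans too thin to contain many
   independent samples of [ly]. *)
Lemma avg_span_proper (n m : nat) : n = \dim {:V} ->
  avg (samples lx n) (fun s => (\dim << s >> < n)%N%:R) <=
  2 ^+ n * (2 ^+ m * eps ^+ m.+1 + 2 * eta ^+ (n - m)).
Proof.
move=> nV; set th := eta ^+ (n - m).
have th0 : 0 <= th by exact: exprn_ge0.
have UT (s : seq V) : (\dim << s >> < n)%N -> (<< s >> != fullv)%VS.
  by apply: contraTneq => ->; rewrite -nV ltnn.
(* A proper span leaves at least one redundant row, and one factor [eps * hits ly U], below
   [2 * th], suffices. *)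
have thin s : s \in samples lx n -> (\dim << s >> < n)%N ->
    hits ly << s >>%VS < 2 * th -> 1 <= 2 * th * weight 0%VS s.
  move=> /size_samples sn dn; have UTs := UT s dn.
  set U := << s >>%VS in dn UTs * => Uth.
  have := @weight_lower 0%VS s (n - \dim U)%N; rewrite add0v -/U dimv0.
  move=> /(_ UTs) h; apply: le_trans (h _) _; first by rewrite sn; lia.
  rewrite mulrC ler_wpM2r ?weight_ge0 //.
  have -> : (n - \dim U = (n - \dim U).-1.+1)%N by rewrite prednK // subn_gt0.
  apply: (@le_trans _ _ (eps * hits ly U)).
    by rewrite exprS ler_piMr ?(ltW (epsq_gt0 _)) // exprn_ile1 // ltW // epsq_gt0.
  by apply: le_trans (ltW Uth); rewrite ler_piMl // hits_ge0.
(* Starting from [m] independent vectors of [U] instead of from nothing leaves [n + m - \dim U]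
   redundant rows, which is more than [m]. *)
have thick s : s \in samples lx n -> (\dim << s >> < n)%N ->
    2 * th <= hits ly << s >>%VS ->
    1 <= 2 ^+ m * eps ^+ m.+1 * avg (samples ly m) (fun r => weight << r >>%VS s).
  move=> /size_samples sn dn; have UTs := UT s dn.
  set U := << s >>%VS in dn UTs * => Uth.
  have q0 : 0 < hits ly U / 2 by rewrite divr_gt0 ?hits_gt0.
  have := @avg_independent U 0%VS m m; rewrite -nV => /(_ Uth).
  rewrite dimv0 add0n leqnn => /(_ isT) h.
  rewrite -(ler_pM2l (exprn_gt0 m q0)) mulr1; apply: le_trans h _.
  rewrite -!avgZ; apply: le_avg => r /size_samples rm.
  case: (boolP (independent_in _ _ _)) => [/independent_inP[rU]|_]; last first.
    by rewrite !mulr_ge0 ?weight_ge0 ?exprn_ge0 // ltW.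
  rewrite add0v dimv0 rm add0n => dr.
  have rsU : (<< r >> + << s >> = U)%VS by apply/addv_idPr.
  have := @weight_lower << r >>%VS s (n + m - \dim U)%N; rewrite rsU dr sn.
  move=> /(_ UTs) {}h; apply: le_trans (h _) _; first by lia.
  (* One factor of [q ^+ m.+1] is bounded by 1; the others cancel against the lower bound
     [(q / 2) ^+ m] on the probability of independence, leaving [2 ^+ m]. *)
  set q := hits ly U; rewrite [leRHS](_ : _ =
    weight << r >>%VS s * (eps ^+ m.+1 * q ^+ m)); last first.
    by rewrite expr_div_n -/q; field; rewrite expf_neq0 // pnatr_eq0.
  apply: ler_wpM2l; first exact: weight_ge0.
  apply: (@le_trans _ _ ((eps * q) ^+ m.+1)).
    by apply: ler_wiXn2l; rewrite ?epsq_le1 ?(ltW (epsq_gt0 _)) //; lia.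
  rewrite exprMn ler_wpM2l ?exprn_ge0 ?(ltW eps_gt0) // exprSr.
  by rewrite ler_piMr ?exprn_ge0 ?hits_ge0 ?hits_le1.
pose T s := 2 * th * weight 0%VS s +
  2 ^+ m * eps ^+ m.+1 * avg (samples ly m) (fun r => weight << r >>%VS s).
have T1 s : 0 <= 2 * th * weight 0%VS s by rewrite !mulr_ge0 ?weight_ge0.
have T2 s : 0 <= 2 ^+ m * eps ^+ m.+1 * avg (samples ly m) (fun r => weight << r >>%VS s).
  apply: mulr_ge0; first by apply: mulr_ge0; apply: exprn_ge0; rewrite // ltW.
  by apply: avg_ge0 => r _; exact: weight_ge0.
apply: (@le_trans _ _ (avg (samples lx n) T)).
  apply: le_avg => s sn; rewrite /T; have [dn|_] := ltnP; last by rewrite addr_ge0.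
  have [/(thin s sn dn)|/(thick s sn dn)] := ltP (hits ly << s >>%VS) (2 * th).
    by move/le_trans; apply; rewrite lerDl.
  by move/le_trans; apply; rewrite lerDr.
(* The auxiliary draws [r] are independent of [s], so [avg_weight] applies for each fixed [r]. *)
rewrite avgD !avgZ avg_exchange mulrDr addrC lerD //.
  rewrite mulrC ler_wpM2r ?mulr_ge0 ?exprn_ge0 ?(ltW eps_gt0) //.
  by apply: avg_le_cst => [|r _]; rewrite ?exprn_ge0 // avg_weight.
by rewrite mulrC ler_wpM2r ?mulr_ge0 // avg_weight.
Qed.

End Exposure.

(** * Matrices of sign sums *)

Definition unit_rows n : seq 'rV[R]_n := [seq delta_mx 0 j | j <- enum 'I_n].

Lemma span_unit_rows n : <<unit_rows n>>%VS = fullv.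
Proof.
apply/eqP; rewrite eqEsubv subvf /=; apply/subvP => v _.
rewrite (row_sum_delta v); apply: memv_suml => j _; apply/memvZ/memv_span.
by apply: map_f; rewrite mem_enum.
Qed.

(** Grouping the entries by rows turns the random matrix into independent row vectors;
    multiplication by [delta_mx i 0] puts a vector into row [i]. *)
Lemma avg_comb_rows n (is_ : seq 'I_n) (c : seq R) (F : 'M[R]_n -> R) :
  avg (comb [seq delta_mx i j | i <- is_, j <- enum 'I_n] c) F =
  avg (samples (comb (unit_rows n) c) (size is_))
    (fun s => F (\sum_(p <- zip is_ s) delta_mx p.1 0 *m p.2)).
Proof.
elim: is_ F => [|i is_ IH] F; first by rewrite !avg_seq1 big_nil.
rewrite [size _]/= avg_samplesS [X in comb X]/= avg_comb_cat.
have -> : [seq delta_mx i j | j <- enum 'I_n] =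
    [seq delta_mx i 0 *m u | u <- unit_rows n].
  by rewrite /unit_rows -map_comp; apply: eq_map => j /=; rewrite mul_delta_mx.
rewrite (avg_comb_linear (mulmx (delta_mx i 0 : 'cV_n))).
apply: eq_avg => x _; rewrite IH; apply: eq_avg => s _.
by rewrite [zip _ _]/= big_cons.
Qed.

(** A nonzero vector of the left kernel is a linear relation between the rows. *)
Lemma singular_span n (s : seq 'rV[R]_n) : size s = n ->
  \sum_(p <- zip (enum 'I_n) s) (delta_mx p.1 0 : 'cV_n) *m p.2 \notin unitmx ->
  (\dim << s >> < n)%N.
Proof.
move=> sn; set M := \sum_(p <- _) _.
have ME : M = \sum_(i < n) delta_mx i 0 *m s`_i.
  rewrite /M; have -> : zip (enum 'I_n) s = [seq (i, s`_i) | i : 'I_n <- enum 'I_n].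
    have {1}-> : s = [seq s`_i | i : 'I_n <- enum 'I_n].
      by rewrite -[LHS](mkseq_nth 0) sn /mkseq -val_enum_ord -map_comp.
    by elim: (enum 'I_n) => //= i e ->.
  by rewrite big_map big_enum.
rewrite unitmxE unitfE negbK => /det0P[v v0 vM].
rewrite -[X in (_ < X)%N]sn ltn_neqAle dim_span andbT; apply: contra v0 => fs.
have /freeP : free (Tuple (introT eqP sn)) by [].
move=> /(_ (fun i => v 0 i)) h; apply/eqP/rowP => i; rewrite mxE; apply: h.
rewrite -[RHS]vM ME mulmx_sumr; apply: eq_bigr => k _.
by rewrite mulmxA -colE [col k v]mx11_scalar mxE mul_scalar_mx.
Qed.

(** Comparing time [t] with time [2 ^ j.+1] allows [j] doublings, and [j] more bound the atoms at
    the shorter time, so [eps] and [eta] are both [(1 - 400^-1) ^+ j]. With [m = n./2] both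
    exponents [m.+1] and [n - m] are at least [uphalf n]. *)
Lemma avg_singular n j t : (2 ^ (j + j).+1 <= t)%N ->
  avg (comb [seq delta_mx i k | i <- enum 'I_n, k <- enum 'I_n] (signs t))
    (fun M : 'M[R]_n => (M \notin unitmx)%:R) <=
  2 ^+ n * (2 ^+ n./2 + 2) * (1 - 400^-1) ^+ (j * uphalf n).
Proof.
move=> jt; rewrite avg_comb_rows size_enum_ord.
set lx := comb _ _; pose ly := comb (unit_rows n) (signs (2 ^ j.+1)).
set a : R := 1 - 400^-1; have a0 : 0 < a by rewrite /a; lra.
have a1 : a <= 1 by rewrite /a; lra.
have nV : n = \dim {:'rV[R]_n} by rewrite dimvf dim_matrix mul1r.
have e0 : 0 < a ^+ j by rewrite exprn_gt0.
have e1 : a ^+ j <= 1 by rewrite exprn_ile1 // ltW.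
have hxy W : W != fullv -> hits lx W <= a ^+ j * hits ly W.
  by move=> WT; apply: subspace_decay => //; exact: span_unit_rows.
have hy (W : {vspace 'rV[R]_n}) : hits ly W <= (a ^+ j) ^+ (\dim {:'rV[R]_n} - \dim W).
  have := comb_subspace_le (unit_rows n) W 0 (ltW e0) (atom_signs_pow2 j).
  have -> : (W + <<unit_rows n>> = fullv)%VS by rewrite span_unit_rows; exact: addvf.
  by apply: le_trans; apply: le_avg => y _; rewrite add0r.
have lx0 : (0 < size lx)%N by apply/comb_size_gt0/signs_size_gt0.
have ly0 : 0 \in ly by apply: mem0_comb; rewrite expnS mul2n -addnn mem0_signs.
have := @avg_span_proper _ lx ly _ _ e0 e1 (ltW e0) e1 hxy hy lx0 ly0 _ n./2 nV.
move=> h; apply: le_trans (le_trans _ h) _.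
  apply: le_avg => s /size_samples sn; rewrite ler_nat.
  case: (boolP (_ \notin _)) => // Ms.
  by rewrite singular_span.
rewrite -mulrA ler_wpM2l ?exprn_ge0 // [leRHS]mulrDl.
have -> : (n - n./2 = uphalf n)%N.
  by have := odd_double_half n; have := uphalf_half n; lia.
rewrite exprM lerD // ler_wpM2l ?exprn_ge0 //.
by apply: ler_wiXn2l; rewrite ?(ltW e0) //; have := uphalf_half n; lia.
Qed.

End SignWalks.

Section Probability.
Variable R : realType.

(** * From random variables to finite laws *)

Lemma measure_bigsetU_le (d : measure_display) (T : measurableType d)
    (P : probability T R) (K : Type) (r : seq K) (B : K -> set T) :
  (forall x, measurable (B x)) ->
  (P (\big[setU/set0]_(x <- r) B x) <= \sum_(x <- r) P (B x))%E.
Proof.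
move=> mB; elim: r => [|x r IH]; first by rewrite !big_nil measure0.
rewrite !big_cons; apply: le_trans (measureU2 _ _ _) _ => //.
  by apply: bigsetU_measurable.
by rewrite leeD2l.
Qed.

(* The law of [X] is carried by the list [c]; one inequality suffices, since
   both sides have total mass [1]. *)
Definition has_law (d : measure_display) (T : measurableType d)
    (P : probability T R) (X : {RV P >-> R}) (c : seq R) : Prop :=
  forall B : set R, measurable B ->
    (P (X @^-1` B) <= (avg c (fun x => (x \in B)%:R : R))%:E)%E.

Section IndependentSum.
Variables (d : measure_display) (T : measurableType d) (P : probability T R).
Variables (I : finType) (X : I -> {RV P >-> R}) (c : seq R).
Variables (V : lmodType R) (v : I -> V) (Phi : pred V).
Hypothesis X_indep : mutually_independent X.
Hypothesis X_law : forall i, has_law (X i) c.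
Hypothesis Phi_meas : measurable [set w | Phi (\sum_i X i w *: v i)].

(** The variables outside [s] are frozen at the values of [g]; induction on [s] then releases them
    one by one. *)
Let pinned (s : seq I) (g : I -> R) : set T :=
  \bigcap_(i in [set i | i \notin s]) (X i @^-1` [set g i]).

Let event s g := [set w | Phi (\sum_i X i w *: v i)] `&` pinned s g.

Let preim_meas i (B : set R) : measurable B -> measurable (X i @^-1` B).
Proof. exact: measurable_funPTI. Qed.

Let pinned_meas s g : measurable (pinned s g).
Proof.
apply: fin_bigcap_measurable; first exact: finite_finset.
by move=> i _; apply: preim_meas; exact: measurable_set1.
Qed.

Let event_meas s g : measurable (event s g).
Proof. exact: measurableI. Qed.

Let prob_atom i x : (P (X i @^-1` [set x]) <= (atom R c x)%:E)%E.
Proof.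
apply: le_trans (X_law i (measurable_set1 x)) _; rewrite lee_fin.
apply: le_avg => y _.
by have -> : (y \in [set x]) = (y == x) by apply/idP/eqP; rewrite inE.
Qed.

Let outside_meas : measurable (~` [set` c] : set R).
Proof.
apply: measurableC; have -> : [set` c] = \big[setU/set0]_(x <- c) [set x].
  rewrite -bigcup_seq; apply/seteqP; split => [x xc|x [y yc ->//]].
  by exists x.
by apply: bigsetU_measurable => x _; exact: measurable_set1.
Qed.

Let prob_outside i : P (X i @^-1` (~` [set` c])) = 0%E.
Proof.
apply/eqP; rewrite eq_le measure_ge0 andbT; apply: le_trans (X_law i outside_meas) _.
rewrite lee_fin; apply: avg_le_cst => // x xc.
by rewrite memNset //; apply.
Qed.

(** Independence enters here: with every variable frozen, the event is an intersection of preimages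
    of points. *)
Let pinned_nil g :
  (P (pinned [::] g) <= (\prod_i atom R c (g i))%:E)%E.
Proof.
have -> : pinned [::] g = \bigcap_(i in [set` [set: I]%SET]) (X i @^-1` [set g i]).
  rewrite /pinned; congr bigcap; apply/seteqP; split => i /= _.
    by rewrite finset.in_setT.
  by [].
rewrite X_indep => [|i]; last exact: measurable_set1.
rewrite [X in (X <= _)%E](eq_bigl xpredT); last by move=> i; rewrite finset.in_setT.
(* Nonnegativity is carried through the induction because multiplying inequalities in the extended
   reals needs it. *)
apply: (proj2 (A := (0 <= \prod_i P (X i @^-1` [set g i]))%E)).
apply: (big_ind2 (fun (x : \bar R) (y : R) => (0 <= x)%E /\ (x <= y%:E)%E)) => //.
by move=> x1 y1 x2 y2 [x10 xy1] [x20 xy2]; rewrite mule_ge0 // EFinM lee_pmul.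
Qed.

Let upd (g : I -> R) i x k := if k == i then x else g k.

(** Almost surely [X i] takes a value in [c]; the event splits according to this value, each
    distinct value being counted once. *)
Let event_cons i s g :
  (P (event (i :: s) g) <= \sum_(x <- undup c) P (event s (upd g i x)))%E.
Proof.
pose N := X i @^-1` (~` [set` c]); set B := fun x => event s (upd g i x).
have mN : measurable N by exact: preim_meas.
have mB x : measurable (B x) by exact: event_meas.
apply: (@le_trans _ _ (P (N `|` \big[setU/set0]_(x <- undup c) B x))).
  apply: le_measure; rewrite ?inE //.
    by apply: measurableU => //; apply: bigsetU_measurable.
  rewrite -bigcup_seq => w [Pw pw].
  have [Xc|Xc] := boolP (X i w \in c); last by left; exact/negP.
  right; exists (X i w); first by rewrite /= mem_undup.
  split=> // k /= ks; rewrite /upd; case: eqP => [->//|/eqP ki].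
  by apply: pw; rewrite /= inE negb_or ki.
apply: le_trans (measureU2 _ _ _) _ => //; first by apply: bigsetU_measurable.
have N0 : (P N <= 0)%E by rewrite /N prob_outside.
rewrite -[leRHS]add0e; apply: leeD; first exact: N0.
exact: (measure_bigsetU_le P (undup c) mB).
Qed.

Let event_le s g : uniq s ->
  (P (event s g) <= (\prod_(i | i \notin s) atom R c (g i) *
     avg (comb (map v s) c)
       (fun y => (Phi (\sum_(i | i \notin s) g i *: v i + y))%:R))%:E)%E.
Proof.
elim: s g => [|i s IH] g /=.
  move=> _; rewrite avg_seq1 addr0.
  have nilT (k : I) : (k \notin [::]) = true by [].
  rewrite !(eq_bigl _ _ nilT).
  case: (boolP (Phi _)) => [_|nPhi].
    rewrite mulr1; apply: le_trans (pinned_nil g).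
    by apply: le_measure; rewrite ?inE // => w [].
  rewrite mulr0 (_ : event _ _ = set0) ?measure0 //.
  apply/seteqP; split => w // [/= Pw pw]; case/negP: nPhi.
  by move: Pw; under eq_bigr do rewrite pw //.
case/andP=> is_ us.
apply: le_trans (event_cons i s g) _.
pose G x := avg (comb (map v s) c) (fun y =>
  (Phi (\sum_(k | k \notin i :: s) g k *: v k + (x *: v i + y)))%:R : R).
have -> : avg (comb (v i :: map v s) c) (fun y =>
    (Phi (\sum_(k | k \notin i :: s) g k *: v k + y))%:R : R) = avg c G.
  by rewrite avg_comb_cons.
have -> : avg c G = \sum_(x <- undup c) atom R c x * G x.
  transitivity (avg c (fun x => G (x - 0))).
    by apply: eq_avg => x _; rewrite subr0.
  rewrite -(@avg_atoms _ c (undup c) 0 G) ?undup_uniq // => [|x].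
    by apply: eq_bigr => x _; rewrite addr0.
  by rewrite subr0 mem_undup.
rewrite mulr_sumr -sumEFin; apply: lee_sum => x _.
apply: le_trans (IH (upd g i x) us) _; rewrite lee_fin.
have D (k : I) : (k \notin i :: s) = (k \notin s) && (k != i).
  by rewrite inE negb_or andbC.
rewrite le_eqVlt; apply/orP; left; apply/eqP.
rewrite !(eq_bigl _ _ D) (bigD1 i) //= {1}/upd eqxx [RHS]mulrCA mulrA; congr (_ * _ * _).
  by apply: eq_bigr => k /andP[_ /negbTE ki]; rewrite /upd ki.
apply: eq_avg => y _; congr (nat_of_bool (Phi _))%:R.
rewrite (bigD1 i) //= {1}/upd eqxx (eq_bigl _ _ D) addrCA addrA; congr (_ + _ + _).
by apply: eq_bigr => k /andP[_ /negbTE ki]; rewrite /upd ki.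
Qed.

Lemma prob_independent_sum (s : seq I) : uniq s -> (forall i, i \in s) ->
  (P [set w | Phi (\sum_i X i w *: v i)%R] <=
   (avg (comb (map v s) c) (fun y => (Phi y)%:R : R))%:E)%E.
Proof.
move=> us sI; have := event_le (fun=> 0) us.
rewrite big1 ?mul1r; last by move=> i; rewrite sI.
rewrite big1; last by move=> i; rewrite sI.
under eq_avg do rewrite add0r.
have -> // : event s (fun=> 0) = [set w | Phi (\sum_i X i w *: v i)].
by apply/seteqP; split => [w []//|w Pw]; split => // i /=; rewrite sI.
Qed.

End IndependentSum.

(** The two atoms already have total mass 1, so everything off them is null. *)
Lemma uniform_sign_law (d : measure_display) (T : measurableType d)
    (P : probability T R) (e : {RV P >-> R}) :
  uniform_sign e -> has_law e [:: 1; -1].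
Proof.
case=> e1 eN1 B mB.
pose S x := e @^-1` [set x : R].
have mS x : measurable (S x) by apply: measurable_funPTI; exact: measurable_set1.
have m_e : measurable (e @^-1` B) by exact: measurable_funPTI.
have PS : P (S 1 `|` S (-1)) = 1%E.
  rewrite measureU //; last first.
    by apply/seteqP; split => w // []; rewrite /S /= => -> h; exfalso; move: h; lra.
  rewrite [X in (X + _)%E]e1 [X in (_ + X)%E]eN1 -EFinD; congr _%:E; lra.
have PN : P (~` (S 1 `|` S (-1))) = 0%E.
  by rewrite probability_setC ?PS ?subee //; exact: measurableU.
pose A x : set T := if x \in B then S x else set0.
have mA x : measurable (A x) by rewrite /A; case: ifP.
have PA x : x = 1 \/ x = -1 -> P (A x) = (2^-1 * (x \in B)%:R)%:E.
  rewrite /A => hx; case: ifP => _; rewrite ?mulr0 ?measure0 // mulr1.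
  by case: hx => ->.
apply: (@le_trans _ _ (P (~` (S 1 `|` S (-1)) `|` (A 1 `|` A (-1))))).
  apply: le_measure; rewrite ?inE //.
    by apply: measurableU; [apply: measurableC|]; exact: measurableU.
  move=> w Bw; have [[h|h]|h] := pselect ((S 1 `|` S (-1)) w); last by left.
    by right; left; rewrite /A -h mem_set.
  by right; right; rewrite /A -h mem_set.
apply: le_trans (measureU2 _ _ _) _.
- by apply: measurableC; exact: measurableU.
- exact: measurableU.
apply: (@le_trans _ _ (P (A 1 `|` A (-1)))).
  rewrite -[leRHS]add0e; apply: leeD => //.
  have : (P (~` (S 1%R `|` S (-1)%R)) <= 0)%E by rewrite PN.
  by [].
apply: le_trans (measureU2 _ _ _) _ => //.
apply: (@le_trans _ _ (P (A 1%R) + P (A (-1)%R))%E) => //.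
rewrite !PA; [|by right|by left].
rewrite -EFinD lee_fin /avg !big_cons big_nil /=; lra.
Qed.

(** The sum is computed on the auxiliary space, as a combination of copies of the vector [1], and
    transported through the law of [X]. *)
Lemma sign_sum_law (d : measure_display) (T : measurableType d)
    (P : probability T R) (t : nat) (X : {RV P >-> R}) :
  distributed_as_sign_sum t X -> has_law X (signs R t).
Proof.
case=> d' [S [Q [e [indep_e sign_e lawX]]]] B mB.
have := lawX B mB; rewrite /distribution /pushforward => ->.
have E (w : S) : \sum_(k < t) e k w *: (1 : R^o) = \sum_(k < t) e k w.
  by apply: eq_bigr => k _; rewrite /GRing.scale /= mulr1.
have meas : measurable [set s | B (\sum_(k < t) e k s)].
  rewrite -[X in measurable X]setTI.
  by apply: (measurable_sum (index_enum 'I_t) (h := fun k => e k)).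
have := @prob_independent_sum _ _ Q _ e [:: 1; -1] R^o (fun=> 1)
  (fun y => y \in B) indep_e
  (fun k => uniform_sign_law (sign_e k)) _ (enum 'I_t) (enum_uniq _) (mem_enum _).
have -> : [set w | (\sum_i e i w *: (1 : R^o)) \in B] = [set s | B (\sum_(k < t) e k s)].
  by apply/funext => w /=; rewrite E; apply/propext; split => [/set_mem|/mem_set].
move=> /(_ meas); have -> // : [seq 1 : R^o | _ <- enum 'I_t] = nseq t 1.
by rewrite -[in RHS](size_enum_ord t); elim: (enum _) => //= k s ->.
Qed.

Lemma det_measurable (d : measure_display) (T : measurableType d)
    (P : probability T R) (n : nat) (X : 'I_n * 'I_n -> {RV P >-> R}) :
  measurable [set w | random_matrix X w \notin unitmx].
Proof.
have -> : [set w | random_matrix X w \notin unitmx] =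
    setT `&` (fun w => \det (random_matrix X w)) @^-1` [set 0].
  rewrite setTI; apply/funext => w; apply/propext => /=.
  by rewrite unitmxE unitfE negbK; split => /eqP.
suff mdet : measurable_fun setT (fun w => \det (random_matrix X w)).
  by apply: mdet => //; exact: measurable_set1.
rewrite /determinant; apply: measurable_sum => s.
apply: measurable_realfun.measurable_funM; first exact: measurable_cst.
apply: measurable_prod => i _; under eq_fun do rewrite mxE.
exact: measurable_funP.
Qed.

Lemma prob_singular (d : measure_display) (T : measurableType d)
    (P : probability T R) (n j t : nat) (X : 'I_n * 'I_n -> {RV P >-> R}) :
  mutually_independent X -> (forall ij, distributed_as_sign_sum t (X ij)) ->
  (2 ^ (j + j).+1 <= t)%N ->
  (P [set w | random_matrix X w \notin unitmx] <=
   (2 ^+ n * (2 ^+ n./2 + 2) * (1 - 400^-1) ^+ (j * uphalf n))%:E)%E.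
Proof.
move=> indep_X lawX jt.
have E w : random_matrix X w = \sum_ij X ij w *: delta_mx ij.1 ij.2.
  rewrite [LHS]matrix_sum_delta pair_big /=.
  by apply: eq_bigr => -[i k] _; rewrite mxE.
pose s : seq ('I_n * 'I_n) := [seq (i, k) | i <- enum 'I_n, k <- enum 'I_n].
have us : uniq s by apply: allpairs_uniq; rewrite ?enum_uniq // => -[? ?] [? ?].
have sI ij : ij \in s by case: ij => i k; apply: allpairs_f; rewrite mem_enum.
have := @prob_independent_sum _ _ P _ X (signs R t) _ (fun ij => delta_mx ij.1 ij.2)
  (fun M : 'M[R]_n => M \notin unitmx) indep_X (fun ij => sign_sum_law (lawX ij)) _
  s us sI.
under [X in measurable X -> _]eq_set do rewrite -E.
under [X in P X]eq_set do rewrite -E.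
move=> /(_ (det_measurable X)) /le_trans; apply.
rewrite lee_fin; have := avg_singular R n jt.
by rewrite /s map_allpairs.
Qed.

(** * Choice of the exponent *)

Lemma small_powers (b : R) (k : R) : 0 < b < 1 -> 0 < k ->
  exists j0, forall j, (j0 <= j)%N -> b ^+ j <= k.
Proof.
move=> /andP[b0 b1] k0.
have : (GRing.exp b : R^nat) @ \oo --> 0.
  by apply: cvg_expr; rewrite gtr0_norm.
move=> /cvgr0_norm_lt /(_ k k0) [j0 _ hj].
exists j0 => j /hj; rewrite ger0_norm ?exprn_ge0 ?(ltW b0) //; exact: ltW.
Qed.

(** The prefactor is at most [8 ^+ n] and the decay at most [b ^+ (2 * j * n)]. Half of that decay
    absorbs the prefactor and still yields the two extra powers of [b] per row. *)
Lemma singular_bound_pow (b : R) (n j : nat) : (0 < n)%N ->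
  0 <= b -> b <= 1 -> 1 - 400^-1 <= b ^+ 4 -> 8 * b ^+ j <= b ^+ 2 ->
  2 ^+ n * (2 ^+ n./2 + 2) * (1 - 400^-1) ^+ (j * uphalf n) <= (b ^+ j.+2) ^+ n.
Proof.
move=> n0 b0 b1 ab hj.
have a0 : 0 <= 1 - 400^-1 :> R by lra.
apply: (@le_trans _ _ (8 ^+ n * (b ^+ (j + j)) ^+ n)).
  apply: ler_pM; rewrite ?mulr_ge0 ?addr_ge0 ?exprn_ge0 //.
    have -> : 8 ^+ n = 2 ^+ n * (2 ^+ n * 2 ^+ n) :> R.
      by rewrite -!exprMn; congr (_ ^+ _); ring.
    rewrite ler_wpM2l ?exprn_ge0 //.
    have h2 : 2 <= 2 ^+ n :> R by rewrite -{1}[2]expr1 ler_eXn2l ?ltr1n.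
    have : 2 ^+ n./2 <= 2 ^+ n :> R by rewrite ler_eXn2l ?ltr1n //; lia.
    by nra.
  rewrite mulnC exprM.
  apply: (@le_trans _ _ ((b ^+ 4) ^+ (uphalf n * j))).
    by rewrite -exprM; apply: lerXn2r; rewrite ?nnegrE ?exprn_ge0.
  rewrite -!exprM; apply: ler_wiXn2l => //.
  by have := uphalf_half n; have := odd_double_half n; nia.
rewrite -exprMn; apply: lerXn2r; rewrite ?nnegrE ?exprn_ge0 ?mulr_ge0 ?exprn_ge0 //.
have -> : b ^+ j.+2 = b ^+ 2 * b ^+ j by rewrite -exprD add2n.
by rewrite exprD mulrA ler_wpM2r ?exprn_ge0.
Qed.

End Probability.

Theorem theorem3p2 (R : realType) :
  exists C : R, 0 < C /\
  exists t0 : nat, forall t : nat, (t0 <= t)%N ->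
  forall (n : nat) (d : measure_display) (T : measurableType d)
    (P : probability T R) (X : 'I_n * 'I_n -> {RV P >-> R}),
  mutually_independent X ->
  (forall ij, distributed_as_sign_sum t (X ij)) ->
  (P [set w | random_matrix X w \notin unitmx]
     <= (t%:R `^ (- (C * n%:R)))%:E)%E.
Proof.
(* The fourth root of the decay factor: one square root pays for the exponent [uphalf n], about half
   of [n], the other for absorbing [8 ^+ n]. *)
pose b : R := Num.sqrt (Num.sqrt (1 - 400^-1)).
have a0 : 0 < 1 - 400^-1 :> R by lra.
have b4 : b ^+ 4 = 1 - 400^-1.
  by rewrite (exprM _ 2 2) !sqr_sqrtr ?sqrtr_ge0 ?(ltW a0).
have b0 : 0 < b by rewrite !sqrtr_gt0.
have b1 : b < 1.
  by rewrite -(@ltr_pXn2r _ 4) ?nnegrE ?(ltW b0) // b4 expr1n; lra.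
have ln4 : 0 < ln (4 : R) by rewrite ln_gt0 // ltr1n.
(* Chosen so that [4] to the power [C] is the inverse of [b]. *)
pose C := - ln b / ln 4; exists C.
have C0 : 0 < C by rewrite divr_gt0 // oppr_gt0 ln_lt0 // b0.
have C4 : 4 `^ C = b^-1 :> R.
  by rewrite /powR pnatr_eq0 /= /C divfK ?gt_eqF // expRN lnK.
split => //.
have k0 : 0 < b ^+ 2 / 8 by rewrite divr_gt0 ?exprn_gt0.
have [|j0 hj0] := @small_powers R b _ _ k0; first by rewrite b0.
exists (4 ^ j0.+1)%N => t t0t n d T P X indep_X lawX.
have tgt0 : (0 < t)%N by apply: leq_trans t0t; rewrite expn_gt0.
case: n X indep_X lawX => [|n] X indep_X lawX.
  rewrite mulr0 oppr0 powRr0.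
  exact: probability_le1 (det_measurable X).
have log_gt0 : (j0.+1 <= trunc_log 4 t)%N.
  by rewrite trunc_log_max.
have /andP[tl tu] := @trunc_log_bounds 4 t isT tgt0.
(* With [j] one less than the logarithm, 4^(j+1) <= t < 4^(j+2): the lower bound provides the
   required number of signs, the upper one turns [b ^+ j.+2] into a power of [t]. *)
move: log_gt0 tl tu; case: (trunc_log 4 t) => // j; rewrite ltnS => j0j tl tu.
have jt : (2 ^ (j + j).+1 <= t)%N.
  apply: leq_trans tl; rewrite -[4%N]/(2 ^ 2)%N -expnM leq_exp2l //; lia.
apply: le_trans (prob_singular indep_X lawX jt) _; rewrite lee_fin.
apply: le_trans (singular_bound_pow _ (ltW b0) (ltW b1) _ _) _ => //.
- by rewrite b4.
- by have := hj0 j j0j; rewrite ler_pdivlMr // mulrC.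
rewrite powRN powRrM powR_mulrn ?powR_ge0 // -exprVn.
apply: lerXn2r; rewrite ?nnegrE ?invr_ge0 ?exprn_ge0 ?powR_ge0 ?(ltW b0) //.
rewrite -[leLHS]invrK lef_pV2 ?posrE ?powR_gt0 ?ltr0n ?invr_gt0 ?exprn_gt0 //.
have -> : (b ^+ j.+2)^-1 = (4 ^+ j.+2) `^ C.
  rewrite -exprVn -[4 ^+ _]powR_mulrn // -powRrM mulrC powRrM C4.
  by rewrite powR_mulrn // invr_ge0 ltW.
apply: ge0_ler_powR; rewrite ?nnegrE ?(ltW C0) ?ler0n ?exprn_ge0 //.
by rewrite -natrX ler_nat ltnW.
Qed.
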